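(* Let $1<q<\infty$, let $m\in\mathbb N$ satisfy $m>q$, and let $\mathscr S$ be a finite subcollection of a dyadic grid on $\mathbb R^n$. Put $q'=q/(q-1)$ and $$\Gamma_{q,m}=\left(\sum_{\ell=1}^{\infty}\binom{\ell+m-2}{m-1}^{-1/(q-1)}\right)^{1/q'} .$$ Then $\Gamma_{q,m}<\infty$, and $$\mathcal A_{\mathscr S}f(x)\le\Gamma_{q,m}\,\mathcal T_{\mathscr S,q}^{\,m}f(x)$$ for every locally integrable $f$ on $\mathbb R^n$ and almost every $x\in\mathbb R^n$, where $\mathcal T_{\mathscr S,q}^{\,m}$ denotes the $m$-fold composition of $\mathcal T_{\mathscr S,q}$.
   Context: For a cube $Q$, $\langle f\rangle_Q=\frac1{|Q|}\int_Q f$. For a finite collection $\mathscr S$ of cubes, $$\mathcal T_{\mathscr S,q}f=\Big(\sum_{Q\in\mathscr S}\langle|f|\rangle_Q^q\,\mathbf 1_Q\Big)^{1/q},\qquad \mathcal A_{\mathscr S}f=\sum_{Q\in\mathscr S}\langle|f|\rangle_Q\,\mathbf 1_Q .$$ Dyadic grid: a collection $\mathscr D=\bigcup_{k\in\mathbb Z}\mathscr D_k$ of half-open cubes $\prod_{i=1}^n[a_i,a_i+\ell)$ such that each $\mathscr D_k$ is a partition of $\mathbb R^n$ into cubes of side length $2^{-k}$; every $Q\in\mathscr D_k$ is contained in a unique cube of $\mathscr D_{k-1}$ and is the disjoint union of exactly $2^n$ cubes of $\mathscr D_{k+1}$; and any $P,Q\in\mathscr D$ satisfy $P\cap Q=\varnothing$,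 $P\subset Q$ or $Q\subset P$. *)

(* Defs.v *)
From HB Require Import structures.
From mathcomp Require Import all_boot all_order all_algebra.
From mathcomp Require Import all_classical all_reals all_analysis.

Set Implicit Arguments.
Unset Strict Implicit.
Unset Printing Implicit Defensive.

Import Order.TTheory GRing.Theory Num.Theory.
Import numFieldNormedType.Exports.

Local Open Scope classical_set_scope.
Local Open Scope ring_scope.
Local Open Scope ereal_scope.

(* Lebesgue measure on the Borel sets of R^n is built by induction on n, as the
   image of (lebesgue_measure \x Lebesgue measure on R^n) under cons.
   Sigma-finiteness is proved by hand: for m1 \x m2, canonical inference finds
   only the instance that requires m1 and m2 to be subprobabilities. *)
Section lebesgue_borel_step.
Context {R : realType} {n : nat}.
Local Notation T := (measurableTypeR R).
Context (mu : {sigma_finite_measure set (n.-tuple T) -> \bar R}).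

Let cons_pair (p : T * n.-tuple T) : n.+1.-tuple T :=
  [the n.+1.-tuple T of p.1 :: p.2].

Let uncons (t : n.+1.-tuple T) : T * n.-tuple T :=
  (tnth t ord0, [tuple of behead t]).

Let pair_uncons p : uncons (cons_pair p) = p.
Proof. by case: p => x t; congr pair; apply/val_inj. Qed.

Let measurable_cons_pair : measurable_fun setT cons_pair.
Proof. exact: measurable_cons. Qed.

Let measurable_uncons : measurable_fun setT uncons.
Proof.
apply/measurable_fun_prod; [exact: measurable_tnth|exact: measurable_behead].
Qed.

Definition lebesgue_borelS : set (n.+1.-tuple T) -> \bar R :=
  pushforward (lebesgue_measure \x mu) cons_pair.

Let lebesgue_borelS0 : lebesgue_borelS set0 = 0.
Proof. by rewrite /lebesgue_borelS /pushforward preimage_set0 measure0. Qed.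

Let lebesgue_borelS_ge0 A : 0 <= lebesgue_borelS A.
Proof. exact: (measure_ge0 (pushforward (lebesgue_measure \x mu) cons_pair)). Qed.

Let lebesgue_borelS_sigma_additive : semi_sigma_additive lebesgue_borelS.
Proof.
exact: (@measure_semi_sigma_additive _ _ _
  (pushforward (lebesgue_measure \x mu) cons_pair)).
Qed.

HB.instance Definition _ := isMeasure.Build _ _ _ lebesgue_borelS
  lebesgue_borelS0 lebesgue_borelS_ge0 lebesgue_borelS_sigma_additive.

Let lebesgue_borelS_sigma_finite : sigma_finite setT lebesgue_borelS.
Proof.
have /sigma_finiteP[F [TF ndF Foo]] := sigma_finiteT (@lebesgue_measure R).
have /sigma_finiteP[G [TG ndG Goo]] := sigma_finiteT mu.
exists (fun k => uncons @^-1` (F k `*` G k)).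
  apply/esym; rewrite -subTset => t _.
  have [k _ Fk] : (\bigcup_k F k) (uncons t).1 by rewrite -TF.
  have [l _ Gl] : (\bigcup_k G k) (uncons t).2 by rewrite -TG.
  exists (maxn k l) => //; split.
    by move: Fk; exact/subsetPset/ndF/leq_maxl.
  by move: Gl; exact/subsetPset/ndG/leq_maxr.
move=> k; have [mF Fk] := Foo k; have [mG Gk] := Goo k; split.
  by rewrite -[X in measurable X]setTI; apply: measurable_uncons => //;
    exact: measurableX.
rewrite /lebesgue_borelS /pushforward -comp_preimage.
rewrite (_ : uncons \o cons_pair = id); last first.
  by apply/funext => p; exact: pair_uncons.
by rewrite preimage_id product_measure1E// lte_mul_pinfty// ge0_fin_numE.
Qed.

HB.instance Definition _ := Measure_isSigmaFinite.Build _ _ _ lebesgue_borelS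
  lebesgue_borelS_sigma_finite.

End lebesgue_borel_step.

Fixpoint lebesgue_borel (R : realType) (n : nat) :
    {sigma_finite_measure set (n.-tuple (measurableTypeR R)) -> \bar R} :=
  match n with
  | 0 => \d_([tuple])
  | n'.+1 => lebesgue_borelS (lebesgue_borel R n')
  end.

(* R^n with the sigma-algebra of all Lebesgue measurable sets, i.e. the
   Caratheodory sigma-algebra of Lebesgue outer measure. *)
Definition Rn (R : realType) (n : nat) : Type :=
  caratheodory_type ((lebesgue_borel R n)^*)%mu.
HB.instance Definition _ (R : realType) (n : nat) := Measurable.on (Rn R n).

Definition lebesgueRn (R : realType) (n : nat) : set (Rn R n) -> \bar R :=
  @completed_measure_extension _ _ _ (lebesgue_borel R n).
Arguments lebesgueRn {R n}.
HB.instance Definition _ (R : realType) (n : nat) :=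
  Measure.on (@lebesgueRn R n).

Definition coordRn (R : realType) (n : nat) (x : Rn R n) (i : 'I_n) : R :=
  tnth (x : n.-tuple R) i.

Definition half_open_cube (R : realType) (n : nat) (a : Rn R n) (l : R) :
    set (Rn R n) :=
  [set x | forall i, (coordRn a i <= coordRn x i < coordRn a i + l)%R].

Lemma half_open_cube_measurable_borel (R : realType) (n : nat)
    (a : n.-tuple (measurableTypeR R)) (l : R) :
  measurable (half_open_cube (a : Rn R n) l :
    set (n.-tuple (measurableTypeR R))).
Proof.
rewrite (_ : half_open_cube _ _ = \bigcap_(i in [set: 'I_n])
    ((@tnth n R) ^~ i @^-1` `[tnth a i, (tnth a i + l)%R[%classic)).
  apply: fin_bigcap_measurable; first exact: finite_finset.
  move=> i _; rewrite -[X in measurable X]setTI.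
  exact: (@measurable_tnth _ (measurableTypeR R) n i measurableT).
apply/seteqP; split=> [x xQ i _|x xQ i]; first by rewrite /= in_itv; exact: xQ.
by have := xQ i Logic.I; rewrite /= in_itv.
Qed.

Lemma lebesgue_borel_cube (R : realType) (n : nat)
    (a : n.-tuple (measurableTypeR R)) (l : R) : (0 <= l)%R ->
  lebesgue_borel R n (half_open_cube (a : Rn R n) l) = (l ^+ n)%:E.
Proof.
move=> l0; elim: n => [|n IH] in a *.
  by rewrite /= diracE expr0 mem_set// => -[].
pose b : n.-tuple (measurableTypeR R) := [tuple of behead a].
have bE i : tnth b i = tnth a (lift ord0 i).
  rewrite tnth_behead; congr (tnth a _); apply/val_inj.
  by rewrite /= inordK ?ltnS.
rewrite /= /lebesgue_borelS /pushforward.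
rewrite [X in (_ \x _) X](_ : _ = `[tnth a ord0, (tnth a ord0 + l)%R[%classic
    `*` half_open_cube (b : Rn R n) l); last first.
  apply/seteqP; split=> [[x t]/= xtQ|[x t]/= [xQ tQ] i].
    split=> [|i]; first by rewrite /= in_itv; exact: (xtQ ord0).
    by have := xtQ (lift ord0 i); rewrite /coordRn tnthS bE.
  rewrite in_itv /= in xQ.
  case: (unliftP ord0 i) => [j ->|->]; last exact: xQ.
  by have := tQ j; rewrite /coordRn tnthS bE.
rewrite product_measure1E//; last exact: half_open_cube_measurable_borel.
rewrite IH [X in X * _](lebesgue_measure_itv `[tnth a ord0, (tnth a ord0 + l)%R[).
rewrite /= lte_fin ltrDl exprS.
case: ifPn => [_|]; first by rewrite -EFinB -EFinM addrAC subrr add0r.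
by rewrite -leNgt => l0'; rewrite (_ : l = 0%R) ?mul0e ?mul0r//;
  apply/le_anti/andP.
Qed.

Lemma lebesgueRn_cube (R : realType) (n : nat) (a : Rn R n) (l : R) :
  (0 <= l)%R ->
  measurable (half_open_cube a l) /\
  lebesgueRn (half_open_cube a l) = (l ^+ n)%:E.
Proof.
move=> l0; have mQ := half_open_cube_measurable_borel a l; split.
  exact: caratheodory_measurable_mu_ext.
by rewrite -(lebesgue_borel_cube a l0); exact: measurable_mu_extE.
Qed.

(* The topology of R^n is that of 'rV[R]_n; tuples carry none. *)
Definition compactRn (R : realType) (n : nat) (K : set (Rn R n)) : Prop :=
  compact [set \row_i coordRn x i | x in K].

Definition locally_integrableRn (R : realType) (n : nat) (f : Rn R n -> R) :
    Prop :=
  measurable_fun setT f /\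
  forall K, compactRn K -> \int[lebesgueRn]_(x in K) `|f x|%:E < +oo.

Definition dyadic_generations (R : realType) (n : nat)
    (Dk : int -> set (set (Rn R n))) : Prop :=
  [/\ forall k Q, Dk k Q -> exists a, Q = half_open_cube a (2 ^ (- k))%R,
      forall k, partition (Dk k) id setT,
      forall k Q, Dk k Q -> exists! P, Dk (k - 1)%R P /\ Q `<=` P,
      forall k Q, Dk k Q -> exists C : set (set (Rn R n)),
        [/\ C `<=` Dk (k + 1)%R, (C #= `I_(2 ^ n)%N)%card & partition C id Q] &
      forall P Q, (\bigcup_k Dk k) P -> (\bigcup_k Dk k) Q ->
        [\/ P `&` Q = set0, P `<=` Q | Q `<=` P]].

Definition dyadic_grid (R : realType) (n : nat) (D : set (set (Rn R n))) :
    Prop :=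
  exists2 Dk : int -> set (set (Rn R n)),
    dyadic_generations Dk & D = \bigcup_k Dk k.

(* Functions take extended real values, so that averages and the iterates of
   sparseT need no finiteness side condition. The sums over S below are
   meaningful for finite S only. *)
Definition avg (R : realType) (n : nat) (f : Rn R n -> \bar R)
    (Q : set (Rn R n)) : \bar R :=
  (\int[lebesgueRn]_(y in Q) f y) / lebesgueRn Q.

Definition sparseT (R : realType) (n : nat) (S : set (set (Rn R n))) (q : R)
    (f : Rn R n -> \bar R) (x : Rn R n) : \bar R :=
  (\sum_(Q \in S) (avg (fun y => `|f y|) Q `^ q * (\1_Q x)%:E)) `^ q^-1.

Definition sparseA (R : realType) (n : nat) (S : set (set (Rn R n)))
    (f : Rn R n -> \bar R) (x : Rn R n) : \bar R :=
  \sum_(Q \in S) (avg (fun y => `|f y|) Q * (\1_Q x)%:E).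

Definition Gamma_qm (R : realType) (q : R) (m : nat) : \bar R :=
  let q' := (q / (q - 1))%R in
  (\sum_(1 <= l <oo)
     (('C(l + m - 2, m - 1)%:R : R) `^ (- (q - 1)^-1))%:E) `^ q'^-1.

(* Main.v *)
Require Import Defs.
From mathcomp Require Import all_boot all_order all_algebra.
From mathcomp Require Import all_classical all_reals all_analysis.
From mathcomp Require Import zify.

(* The cubes of S through x form a chain Q_0 > ... > Q_(N-1). Since T f is at
   least (sum_(j <= i) <f>_(Q_j)^q)^(1/q) on all of Q_i, so is its average over
   Q_i; hence each application of T takes partial sums of the q-th powers of
   the averages along the chain. Iterated partial sums have binomial weights:
     (T^m f x)^q >= sum_(j < N) 'C(N - 1 - j + m - 1, m - 1) <f>_(Q_j)^q,
   and Hoelder's inequality against these weights gives A f x. The weights grow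
   like the power m - 1 of N - j, and (m - 1)/(q - 1) > 1, so Gamma is
   finite. *)

Import Order.TTheory GRing.Theory Num.Theory.
Import numFieldNormedType.Exports.

Local Open Scope classical_set_scope.
Local Open Scope ring_scope.

(** * Elementary estimates for binomials, series and finite sums *)

(** Times k factorial, the binomial is the product l (l + 1) ... (l + k - 1), whose k factors are
    all at least l. *)
Lemma leq_expn_binM_fact (k l : nat) :
  (0 < l -> l ^ k <= 'C(l + k - 1, k) * k`!)%N.
Proof.
move=> l0; rewrite bin_ffact; elim: k => [|k IH]; first by rewrite expn0 ffactn0.
by rewrite addnS subn1 /= ffactnS expnS -subn1 leq_mul ?leq_addr.
Qed.

(** Cauchy condensation: the dyadic block starting at [2 ^ j] has [2 ^ j] terms, the first being the
    largest. *)
Lemma sum_expn2_le (R : realType) (u : nat -> R) (k : nat) :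
  (forall i j, (0 < i <= j)%N -> u j <= u i) ->
  \sum_(1 <= l < (2 ^ k)%N) u l <= \sum_(j < k) (2 ^ j)%:R * u (2 ^ j)%N.
Proof.
move=> u_dec; elim: k => [|k IH]; first by rewrite big_ord0 expn0 big_geq.
rewrite big_ord_recr (@big_cat_nat _ _ _ (2 ^ k)%N) ?expn_gt0 ?leq_exp2l //=.
apply: lerD => //.
apply: (@le_trans _ _ (\sum_((2 ^ k)%N <= l < (2 ^ k.+1)%N) u (2 ^ k)%N)).
  rewrite big_nat_cond [leRHS]big_nat_cond; apply: ler_sum => l.
  by rewrite andbT => /andP[lk _]; apply: u_dec; rewrite expn_gt0.
by rewrite sumr_const_nat expnS mul2n -addnn addnK mulr_natl.
Qed.

(** Condensation leads to a geometric series of ratio [z], which is less than 1 because [1 < s]. *)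
Lemma nneseries_powRN_lty (R : realType) (s : R) : 1 < s ->
  (\sum_(1 <= l <oo) ((l%:R : R) `^ (- s))%:E < +oo)%E.
Proof.
move=> s1; pose z : R := 2 `^ (1 - s).
have z0 : 0 < z by rewrite powR_gt0.
have z1 : z < 1.
  rewrite /z -opprB powRN invf_lt1 ?powR_gt0//.
  suff : 1 `^ (s - 1) < 2 `^ (s - 1) by rewrite powR1.
  by apply: gt0_ltr_powR; rewrite ?nnegrE ?subr_gt0 ?ltr1n.
have s0 : 0 <= s by rewrite ltW// (lt_trans ltr01).
apply: (@le_lt_trans _ _ ((1 - z)^-1)%:E); last exact: ltry.
apply: lime_le => [|].
  by apply: is_cvg_nneseries => l _ _; rewrite lee_fin powR_ge0.
apply: nearW => N.
(* Enlarging the range to whole dyadic blocks only adds nonnegative terms. *)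
apply: (@le_trans _ _ (\sum_(1 <= l < (2 ^ N)%N) ((l%:R : R) `^ (- s))%:E)%E).
  case: N => [|N]; first by rewrite !big_geq.
  rewrite [leRHS](@big_cat_nat _ _ _ N.+1) //=; last by rewrite ltnW// ltn_expl.
  by rewrite leeDl// sume_ge0// => i _; rewrite lee_fin powR_ge0.
rewrite sumEFin lee_fin; apply: le_trans (sum_expn2_le _ _ _ _) _.
  move=> i j /andP[i0 ij]; rewrite !powRN lef_pV2 ?posrE ?powR_gt0 ?ltr0n//; last first.
    exact: leq_trans ij.
  by rewrite ge0_ler_powR ?nnegrE ?ler0n ?ler_nat.
have -> : \sum_(j < N) (2 ^ j)%:R * ((2 ^ j)%:R : R) `^ (- s) = \sum_(j < N) z ^+ j.
  apply: eq_bigr => j _.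
  rewrite -{1}(@powRr1 _ (2 ^ j)%:R) ?ler0n// -powRD ?pnatr_eq0 ?expn_eq0 ?implybT//.
  by rewrite natrX -powR_mulrn // -powRrM mulrC powRrM powR_mulrn ?powR_ge0.
have z1' : 0 < 1 - z by rewrite subr_gt0.
rewrite -[leRHS]mul1r ler_pdivlMr// mulrC -opprB mulNr -subrX1 opprB.
by rewrite gerBl exprn_ge0 ?ltW.
Qed.

(** Induction on [N]: the two-term inequality is applied to the norms of the first [N] entries and
    the new entry. *)
Lemma sum_hoelder (R : realType) (p q : R) (N : nat) (a b : nat -> R) :
  0 < p -> 0 < q -> p^-1 + q^-1 = 1 ->
  (forall j, 0 <= a j) -> (forall j, 0 <= b j) ->
  \sum_(j < N) a j * b j <=
  (\sum_(j < N) a j `^ p) `^ p^-1 * (\sum_(j < N) b j `^ q) `^ q^-1.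
Proof.
move=> p0 q0 pq a0 b0; elim: N => [|N IH].
  by rewrite !big_ord0 mulr_ge0 ?powR_ge0.
have sum_ge0 (c : nat -> R) r : 0 <= \sum_(j < N) c j `^ r.
  by apply: sumr_ge0 => *; exact: powR_ge0.
have rootK (c : nat -> R) r : 0 < r ->
    ((\sum_(j < N) c j `^ r) `^ r^-1) `^ r = \sum_(j < N) c j `^ r.
  by move=> r0; rewrite -powRrM mulVf ?gt_eqF// powRr1.
rewrite !big_ord_recr /= -{1}(rootK a p p0) -{1}(rootK b q q0).
apply: le_trans (hoelder2 _ _ _ _ p0 q0 pq); rewrite ?powR_ge0//.
exact: lerD.
Qed.

(** * Iterated partial sums *)

Definition partial_sum (V : nmodType) (a : nat -> V) (i : nat) : V :=
  \sum_(j < i.+1) a j.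

(** Double induction through Pascal's rule. The coefficients are natural multiples, so that the
    formula covers sequences in [\bar R]. *)
Lemma iter_partial_sum (V : nmodType) (a : nat -> V) (r i : nat) :
  iter r.+1 (@partial_sum V) a i = (\sum_(j < i.+1) a j *+ 'C(i - j + r, r))%R.
Proof.
elim: r i => [|r IHr] i.
  by rewrite /= /partial_sum; apply: eq_bigr => j _; rewrite bin0.
elim: i => [|i IHi].
  by rewrite iterS /partial_sum !big_ord1 IHr big_ord1 !binn.
have -> : iter r.+2 (@partial_sum V) a i.+1 =
    (iter r.+2 (@partial_sum V) a i + iter r.+1 (@partial_sum V) a i.+1)%R.
  by rewrite iterS {1}/partial_sum big_ord_recr.
rewrite IHi IHr /= [in RHS]big_ord_recr [X in (_ + X)%R]big_ord_recr /=.
rewrite subnn !binn addrA -big_split /=; congr (_ + _)%R.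
apply: eq_bigr => j _; rewrite -mulrnDr; congr (_ *+ _)%R.
by rewrite subSn ?leq_ord// [in RHS]addSn [in RHS]binS addnS addSn.
Qed.

Local Open Scope ereal_scope.

(** * Powers and averages in the extended reals *)

Lemma poweRVK (R : realType) (r : R) (x : \bar R) :
  (r != 0)%R -> 0 <= x -> (x `^ r^-1) `^ r = x.
Proof. by move=> r0 x0; rewrite -poweRrM mulVf// poweRe1. Qed.

Lemma poweRKV (R : realType) (r : R) (x : \bar R) :
  (r != 0)%R -> 0 <= x -> (x `^ r) `^ r^-1 = x.
Proof. by move=> r0 x0; rewrite -poweRrM mulfV// poweRe1. Qed.

Lemma le_poweR (R : realType) (x y : \bar R) (r : R) :
  (0 <= r)%R -> 0 <= x -> x <= y -> x `^ r <= y `^ r.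
Proof.
move=> r0 x0 xy; apply: gt0_ler_poweR; rewrite ?in_itv/= ?leey ?andbT//.
exact: le_trans xy.
Qed.

(* The integral of a nonnegative function, measurable or not, is the supremum
   over the simple functions below it. *)
Lemma ge0_le_integral_nonmeasurable (d : measure_display) (T : measurableType d)
    (R : realType) (mu : {measure set T -> \bar R}) (D : set T)
    (f g : T -> \bar R) :
  (forall x, D x -> 0 <= f x) -> (forall x, D x -> f x <= g x) ->
  \int[mu]_(x in D) f x <= \int[mu]_(x in D) g x.
Proof.
move=> f0 fg; have g0 x : D x -> 0 <= g x.
  by move=> Dx; exact: le_trans (f0 _ Dx) (fg _ Dx).
rewrite !ge0_integralE//; apply: ereal_sup_le => _ [h /= hf <-].
exists h => //= x; apply: le_trans (hf x) _; rewrite /patch.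
by case: ifPn => // /[!inE]; exact: fg.
Qed.

Lemma avg_ge0 (R : realType) (n : nat) (f : Rn R n -> \bar R) (Q : set (Rn R n)) :
  (forall y, 0 <= f y) -> 0 <= avg f Q.
Proof. by move=> f0; rewrite mule_ge0 ?integral_ge0// inve_ge0. Qed.

(** The cube has positive finite measure, so the average of the constant [c] is [c], even for
    [c = +oo]. *)
Lemma avg_cube_ge (R : realType) (n : nat) (f : Rn R n -> \bar R) (a : Rn R n)
    (l : R) (c : \bar R) :
  (0 < l)%R -> 0 <= c ->
  (forall y, half_open_cube a l y -> c <= f y) ->
  c <= avg f (half_open_cube a l).
Proof.
move=> l0 c0 cf; have [mQ muQ] := lebesgueRn_cube a (ltW l0).
have ln0 : (0 < l ^+ n)%R by rewrite exprn_gt0.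
rewrite /avg muQ inver gt_eqF// lee_pdivlMr// -muQ -integral_cst//.
exact: ge0_le_integral_nonmeasurable.
Qed.

(** * Lower bounds for iterates of [sparseT] along a chain of cubes *)

Section sparse_operator.
Context (R : realType) (n : nat) (S : set (set (Rn R n))) (q : R).
Hypotheses (q0 : (0 < q)%R) (finS : finite_set S).

Lemma sparseT_ge0 (f : Rn R n -> \bar R) x : 0 <= sparseT S q f x.
Proof. exact: poweR_ge0. Qed.

Lemma sparseT_poweR (f : Rn R n -> \bar R) x :
  sparseT S q f x `^ q =
  \sum_(Q \in S) (avg (fun y => `|f y|) Q `^ q * (\1_Q x)%:E).
Proof.
rewrite /sparseT poweRVK ?gt_eqF//.
by apply: fsume_ge0 => Q _; rewrite mule_ge0 ?poweR_ge0// lee_fin.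
Qed.

Lemma sum_le_fsum_indic (F : set (Rn R n) -> \bar R) (s : seq (set (Rn R n))) x :
  (forall Q, 0 <= F Q) -> uniq s -> [set` s] `<=` S ->
  {in s, forall Q, Q x} ->
  \sum_(Q <- s) F Q <= \sum_(Q \in S) (F Q * (\1_Q x)%:E).
Proof.
move=> F0 us sS sx.
rewrite (eq_big_seq (fun Q : set (Rn R n) => F Q * (\1_Q x)%:E)); last first.
  by move=> Q /sx Qx; rewrite indicE mem_set// mule1.
rewrite fsbig_seq//; apply: lee_fsum_nneg_subset => //.
- by move=> Q; rewrite !inE => sQ; exact: sS.
by move=> Q _; rewrite mule_ge0// lee_fin.
Qed.

Lemma fsum_indicE (F : set (Rn R n) -> \bar R) (s : seq (set (Rn R n))) x :
  uniq s -> [set` s] = S `&` [set Q | Q x] ->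
  \sum_(Q \in S) (F Q * (\1_Q x)%:E) = \sum_(Q <- s) F Q.
Proof.
move=> us sE.
transitivity (\sum_(Q \in S `&` [set Q : set (Rn R n) | Q x]) F Q); last first.
  by rewrite [RHS]fsbig_seq// sE.
rewrite (fsbigID [set Q : set (Rn R n) | Q x])//.
rewrite [X in _ + X = _]fsbig1 ?adde0.
  by apply: eq_fsbigr => Q /[!inE] -[_ Qx]; rewrite indicE mem_set// mule1.
by move=> Q [_ nQx]; rewrite indicE memNset// mule0.
Qed.

(** The bound is proved at every point of every cube of the chain, because the next iterate averages
    over whole cubes. *)
Lemma iter_sparseT_chain (f : Rn R n -> \bar R) (s : seq (set (Rn R n))) :
  (forall Q, S Q -> exists a l, (0 < l)%R /\ Q = half_open_cube a l) ->
  uniq s -> [set` s] `<=` S ->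
  (forall i j, (i <= j < size s)%N -> nth set0 s j `<=` nth set0 s i) ->
  forall r i y, (i < size s)%N -> nth set0 s i y ->
  iter r.+1 (@partial_sum (\bar R))
    (fun j => avg (fun z => `|f z|) (nth set0 s j) `^ q) i <=
  iter r.+1 (sparseT S q) f y `^ q.
Proof.
move=> cubeS us sS nested.
set a := fun j : nat => avg _ _ `^ q.
pose T r := iter r (sparseT S q) f.
have a0 r j : 0 <= iter r (@partial_sum (\bar R)) a j.
  elim: r j => [|r IH] j; first exact: poweR_ge0.
  by rewrite iterS; exact: sume_ge0.
(* One application of [sparseT] adds one partial sum: a point of the cube of index i lies in all
   cubes of index at most i, and any other cube of [S] contributes a nonnegative term. *)
have step r : (forall i, (i < size s)%N -> iter r (@partial_sum (\bar R)) a i <=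
      avg (fun z => `|T r z|) (nth set0 s i) `^ q) ->
    forall i y, (i < size s)%N -> nth set0 s i y ->
    iter r.+1 (@partial_sum (\bar R)) a i <= T r.+1 y `^ q.
  move=> IH i y si yi; rewrite /T !iterS sparseT_poweR.
  apply: (@le_trans _ _ (\sum_(Q <- take i.+1 s) avg (fun z => `|T r z|) Q `^ q)).
    rewrite (big_nth set0) size_takel// big_mkord; apply: lee_sum => j _.
    by rewrite nth_take//; apply: IH; exact: leq_ltn_trans (leq_ord j) si.
  apply: sum_le_fsum_indic => //.
  - by move=> Q; exact: poweR_ge0.
  - exact: take_uniq.
  - by move=> Q /= /mem_take Qs; exact: sS.
  - move=> Q /(nthP set0)[j]; rewrite size_takel// => ji <-.
    by rewrite nth_take//; apply: nested yi; rewrite -ltnS ji.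
elim=> [|r IH]; apply: step => // i si.
have Si : S (nth set0 s i) by apply: sS; exact: mem_nth.
(* Taking q-th roots reduces the goal to a constant lower bound for the iterate on the cube, which
   passes to its average. *)
rewrite -[leLHS](@poweRVK _ q) ?gt_eqF//; apply: le_poweR; [exact: ltW|exact: poweR_ge0|].
have [b [l [l0 Qbl]]] := cubeS _ Si.
rewrite Qbl; apply: avg_cube_ge => //; first exact: poweR_ge0.
move=> y; rewrite -Qbl => yi; rewrite gee0_abs ?sparseT_ge0//.
rewrite -[leRHS](@poweRKV _ q) ?sparseT_ge0 ?gt_eqF//; apply: le_poweR => //.
  by rewrite invr_ge0 ltW.
exact: IH yi.
Qed.

End sparse_operator.

(** Sorting by reverse inclusion puts the largest set first. This relation is total only among the
    members of [S], hence the relative form of sortedness. *)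
Lemma finite_chain_sorted (T : Type) (S : set (set T)) :
  finite_set S -> (forall P Q, S P -> S Q -> P `<=` Q \/ Q `<=` P) ->
  exists s : seq (set T), [/\ uniq s, [set` s] = S &
    forall i j, (i <= j < size s)%N -> nth set0 s j `<=` nth set0 s i].
Proof.
move=> /finite_seqP[s ->] total.
pose leS : rel (set T) := fun P Q => `[< Q `<=` P >].
exists (sort leS (undup s)); split.
- by rewrite sort_uniq undup_uniq.
- by apply/seteqP; split => Q /=; rewrite mem_sort mem_undup.
move=> i j /andP[ij js]; apply/asboolP.
apply: (sorted_leq_nth (leT := leS)) => //.
- by move=> P Q W /asboolP QP /asboolP PW; apply/asboolP; exact: subset_trans QP.
- by move=> P; apply/asboolP.
- apply: (sort_sorted_in (P := mem s)).
    move=> P Q SP SQ; have [PQ|QP] := total _ _ SP SQ; apply/orP.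
      by right; apply/asboolP.
    by left; apply/asboolP.
  by apply/allP => Q; rewrite mem_undup.
- by rewrite inE (leq_ltn_trans ij).
Qed.

(** * Weighted Hoelder inequality and the constant Gamma *)

Lemma sum_le_weighted (R : realType) (q : R) (N : nat) (w : nat -> nat)
    (a : nat -> \bar R) :
  (1 < q)%R -> (forall j, 0 < w j)%N -> (forall j, 0 <= a j) ->
  \sum_(j < N) a j <=
  ((\sum_(j < N) ((w j)%:R : R) `^ (- (q - 1)^-1)) `^ (q / (q - 1))^-1)%:E *
  (\sum_(j < N) (w j)%:R%:E * a j `^ q) `^ q^-1.
Proof.
move=> q1 w0 a0; have q0 : (0 < q)%R by rewrite (lt_trans ltr01).
have q10 : (0 < q - 1)%R by rewrite subr_gt0.
set G := (\sum_(j < N) _ `^ _)%R.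
have aq0 (i : nat) : 0 <= (w i)%:R%:E * a i `^ q.
  by apply: mule_ge0; rewrite ?poweR_ge0// lee_fin.
(* If some [a i] is infinite, so is the right-hand side: its first factor is positive, which
   excludes the product of 0 and [+oo]. *)
have [[i /eqP aiy]|afin] := pselect (exists i : 'I_N, a i == +oo).
  have G0 : (0 < G)%R.
    rewrite /G (bigD1 i)//= ltr_pwDl ?powR_gt0 ?ltr0n//.
    by apply: sumr_ge0 => *; exact: powR_ge0.
  have -> : \sum_(j < N) (w j)%:R%:E * a j `^ q = +oo.
    apply/eqP; rewrite -leye_eq (bigD1 i)//= aiy poweRyr ?gt_eqF//.
    by rewrite gt0_muley ?lte_fin ?ltr0n// leeDl// sume_ge0.
  by rewrite poweRyr ?invr_neq0 ?gt_eqF// gt0_muley ?leey// lte_fin powR_gt0.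
have aE (i : 'I_N) : a i = (fine (a i))%:E.
  rewrite fineK// ge0_fin_numE// ltey; apply/eqP => aiy.
  by apply: afin; exists i; exact/eqP.
rewrite (eq_bigr _ (fun i _ => aE i)) sumEFin.
rewrite [X in X `^ q^-1](eq_bigr (fun j : 'I_N =>
    ((w j)%:R * fine (a j) `^ q)%R%:E)); last first.
  by move=> j _; rewrite {1}aE poweR_EFin -EFinM.
rewrite sumEFin poweR_EFin -EFinM lee_fin mulrC.
(* Each term is split as (w^(1/q) a) w^(-1/q); the conjugate exponent q/(q - 1) turns the last
   factor into w^(-1/(q - 1)). *)
rewrite (eq_bigr (fun j : 'I_N =>
    ((w j)%:R `^ q^-1 * fine (a j)) * (w j)%:R `^ (- q^-1))%R); last first.
  move=> j _; rewrite mulrAC -powRD; last by rewrite pnatr_eq0 -lt0n w0 implybT.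
  by rewrite subrr powRr0 mul1r.
have qq : (q^-1 + (q / (q - 1))^-1 = 1)%R.
  by rewrite invf_div mulrBl mul1r divff ?gt_eqF// addrC subrK.
have := sum_hoelder _ _ _ N (fun j => ((w j)%:R `^ q^-1 * fine (a j))%R)
  (fun j => ((w j)%:R `^ (- q^-1))%R) q0 (divr_gt0 q0 q10) qq.
move=> /(_ (fun j => mulr_ge0 (powR_ge0 _ _) (fine_ge0 (a0 j))))
  /(_ (fun j => powR_ge0 _ _)).
move=> /le_trans; apply.
rewrite le_eqVlt; apply/orP; left; apply/eqP.
congr (_ `^ _ * _ `^ _)%R; apply: eq_bigr => j _.
  by rewrite powRM ?powR_ge0 ?fine_ge0// -powRrM mulVf ?gt_eqF// powRr1.
by rewrite -powRrM mulNr mulrA mulVf ?gt_eqF// mul1r.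
Qed.

Lemma Gamma_qm_ge (R : realType) (q : R) (m N : nat) :
  (1 < q)%R -> (0 < m)%N ->
  ((\sum_(j < N) ('C(N.-1 - j + m.-1, m.-1)%:R : R) `^ (- (q - 1)^-1))
    `^ (q / (q - 1))^-1)%:E <= Gamma_qm q m.
Proof.
move=> q1 m0; rewrite /Gamma_qm -poweR_EFin; apply: le_poweR.
- by rewrite invr_ge0 divr_ge0// ?subr_ge0 ltW// (lt_trans ltr01).
- by rewrite lee_fin; apply: sumr_ge0 => *; exact: powR_ge0.
(* The series starts at 1, so its first [N] terms end before [N.+1]; reversing the order of
   summation matches them with the weights. *)
apply: le_trans (nneseries_lim_ge N.+1 _); last first.
  by move=> *; rewrite lee_fin powR_ge0.
rewrite sumEFin lee_fin big_add1 /= big_mkord (reindex_inj rev_ord_inj) /=.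
rewrite le_eqVlt; apply/orP; left; apply/eqP; apply: eq_bigr => j _.
have -> : (N.-1 - (N - j.+1) + m.-1 = j.+1 + m - 2)%N by have := ltn_ord j; lia.
by rewrite subn1.
Qed.

(** The binomial is at least l^(m - 1) / (m - 1)!, so the terms are at most a constant times l^(-s),
    and [1 < s] follows from q < m. *)
Lemma Gamma_qm_lty (R : realType) (q : R) (m : nat) :
  (1 < q)%R -> (q < m%:R)%R -> Gamma_qm q m < +oo.
Proof.
move=> q1 qm; apply: poweR_lty.
have q10 : (0 < q - 1)%R by rewrite subr_gt0.
have m1 : (1 < m)%N by rewrite -(ltr_nat R) (lt_trans _ qm).
pose e := ((q - 1)^-1)%R; have e0 : (0 < e)%R by rewrite invr_gt0.
pose s := (m.-1%:R * e)%R.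
have s1 : (1 < s)%R.
  by rewrite /s /e ltr_pdivlMr// mul1r -subn1 natrB ?(ltnW m1)// ltrD2r.
apply: (@le_lt_trans _ _ (\sum_(1 <= l <oo)
    (((m.-1)`!%:R : R) `^ e)%:E * ((l%:R : R) `^ (- s))%:E)).
  apply: lee_nneseries => [l _ _|[_|l _]]; first by rewrite lee_fin powR_ge0.
    (* The comparison is also required at l = 0, where the binomial vanishes; a power of 0 with
       negative exponent is 0 by convention. *)
    rewrite bin_small; last lia.
    by rewrite powR0 ?oppr_eq0 ?invr_eq0 ?gt_eqF// mule_ge0// lee_fin powR_ge0.
  rewrite -EFinM lee_fin -/e powRN mulrC powRN.
  rewrite ler_pdivlMl ?powR_gt0 ?ltr0n//.
  rewrite -ler_pdivlMr ?invr_gt0 ?powR_gt0 ?ltr0n ?bin_gt0//; last lia.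
  rewrite invrK /s powRrM powR_mulrn// -powRM//.
  rewrite ge0_ler_powR ?nnegrE ?mulr_ge0 ?exprn_ge0 ?ler0n ?(ltW e0)//.
  rewrite -natrX -natrM ler_nat mulnC.
  have := leq_expn_binM_fact m.-1 l.+1 isT.
  by rewrite (_ : l.+1 + m.-1 - 1 = l.+1 + m - 2)%N ?subn1//; lia.
rewrite nneseriesZl; last by move=> *; rewrite lee_fin powR_ge0.
by rewrite lte_mul_pinfty ?lee_fin ?powR_ge0// nneseries_powRN_lty.
Qed.

(** * Pointwise domination at a fixed point *)

Theorem theorem3p2 (R : realType) (n : nat) (q : R) (m : nat)
    (D S : set (set (Rn R n))) :
  (1 < q)%R -> (q < m%:R)%R ->
  dyadic_grid D -> finite_set S -> S `<=` D ->
  Gamma_qm q m < +oo /\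
  forall f : Rn R n -> R, locally_integrableRn f ->
    {ae lebesgueRn, forall x,
      sparseA S (EFin \o f) x <= Gamma_qm q m * iter m (sparseT S q) (EFin \o f) x}.
Proof.
move=> q1 qm [Dk [Dcube _ _ _ Dnest] DE] finS SD; split; first exact: Gamma_qm_lty.
move=> f _; apply: aeW => x.
have q0 : (0 < q)%R by rewrite (lt_trans ltr01).
have m0 : (0 < m)%N by rewrite -(ltr_nat R) (lt_trans q0).
pose Sx := S `&` [set Q : set (Rn R n) | Q x].
have finSx : finite_set Sx by apply: sub_finite_set finS => Q [].
(* Two cubes through x are nested, since x rules out the disjoint case of the dyadic trichotomy. *)
have [P Q [SP Px] [SQ Qx]|s [us sE nested]] := finite_chain_sorted _ Sx finSx.
  have [||PQ0|PQ|QP] := Dnest P Q; rewrite -?DE; try exact: SD; [|by left|by right].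
  by suff : set0 x by []; rewrite -PQ0.
have cubeS Q : S Q -> exists a l, (0 < l)%R /\ Q = half_open_cube a l.
  move=> /SD; rewrite DE => -[k _ /Dcube[a ->]].
  by exists a, (2 ^ (- k))%R; split=> //; rewrite exprz_gt0.
have sS : [set` s] `<=` S by rewrite sE => Q [].
pose a (j : nat) := avg (fun y => `|(EFin \o f) y|) (nth set0 s j).
have a0 j : 0 <= a j by exact: avg_ge0.
have -> : sparseA S (EFin \o f) x = \sum_(j < size s) a j.
  by rewrite /sparseA (fsum_indicE _ _ _ finS _ s)// (big_nth set0) big_mkord.
(* The empty chain is set aside so that [(size s).-1] is the index of the smallest cube through
   x. *)
have [s0|s0] := posnP (size s).
  rewrite s0 big_ord0 mule_ge0 ?poweR_ge0//.
  by case: m m0 {qm} => // r _; rewrite iterS sparseT_ge0.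
(* These weights are the coefficients of the m-fold partial sum at the last index, as given by
   [iter_partial_sum]. *)
apply: le_trans (sum_le_weighted _ q _ (fun j => 'C((size s).-1 - j + m.-1, m.-1))
  _ q1 _ a0) _.
  by move=> j; rewrite bin_gt0 leq_addl.
apply: lee_pmul; rewrite ?poweR_ge0//; first by rewrite lee_fin powR_ge0.
  exact: Gamma_qm_ge.
have last_x : nth set0 s (size s).-1 x.
  by suff [] : Sx (nth set0 s (size s).-1) by []; rewrite -sE /= mem_nth ?prednK.
have := iter_sparseT_chain _ _ _ _ q0 finS (EFin \o f) s cubeS us sS nested
  m.-1 (size s).-1 x _ last_x.
rewrite iter_partial_sum !prednK// => /(_ (leqnn _)) le_iter.
rewrite -[leRHS](@poweRKV _ q) ?gt_eqF//; last first.
  by case: m m0 {qm le_iter} => // r _; rewrite iterS sparseT_ge0.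
apply: le_poweR; first by rewrite invr_ge0 ltW.
  by apply: sume_ge0 => j _; rewrite mule_ge0 ?poweR_ge0// lee_fin.
apply: le_trans le_iter; apply: lee_sum => j _.
by rewrite mule_natl.
Qed.
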